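(* Let $\mathbb{K}$ be a commutative unital ring and $V,W$ two $\mathbb{K}$-modules. Every polynomial law $P:\underline{V}\to\underline{W}$ gives rise to a $C^1_{\mathbb{K}}$-law $\mathbf{P}$ from $V$ to $W$ over the base map $P_{\mathbb{K}}:V\to W$. More precisely, letting, for $r\in\mathbb{K}$, $P_r:=P_{\mathbb{K}[X]/(X^2-rX)}:V_r\to W_r$, the map $P^{\overline{\{1\}}}:V^2\times\mathbb{K}^2\to W^2\times\mathbb{K}^2$ is obtained by $$P^{\overline{\{1\}}}(x,v;s,t):=(P_{st}(x,v);s,t).$$ In particular, the tangent map $TP:TV\to TW$ is given by scalar extension by dual numbers $\mathbb{K}[X]/(X^2)$, and for each $x\in V$ the differential $dP(x):V\to W$, $v\mapsto \mathrm{pr}_2(P_0(x,v))$, is $\mathbb{K}$-linear.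
   Context: Polynomial laws (Roby). For a $\mathbb{K}$-module $V$, $\underline{V}$ is the functor from unital commutative $\mathbb{K}$-algebras to sets with $\underline V(\mathbb{A})=V_{\mathbb{A}}=V\otimes_{\mathbb{K}}\mathbb{A}$ and, for an algebra morphism $\phi:\mathbb{A}\to\mathbb{B}$, $\phi_V=\mathrm{id}\otimes\phi:V_{\mathbb{A}}\to V_{\mathbb{B}}$. A polynomial law between $V$ and $W$ is a natural transformation $P:\underline V\to\underline W$, i.e. a family of maps $P_{\mathbb{A}}:V_{\mathbb{A}}\to W_{\mathbb{A}}$ with $P_{\mathbb{B}}\circ\phi_V=\phi_W\circ P_{\mathbb{A}}$; $P_{\mathbb{K}}:V\to W$ is its base map. For $r\in\mathbb{K}$, $V_r:=V\otimes_{\mathbb{K}}\mathbb{K}[X]/(X^2-rX)$ is identified with $V\times V$ via $(x,v)\leftrightarrow x\otimes[1]+v\otimes[X]$; likewise for $W$; $\mathrm{pr}_2:W\times W\to W$ is the second projection. $C^1_{\mathbb{K}}$-laws. For a map $f:V\to W$, a difference factorizer is a map $f^{[1]}:V\times V\times\mathbb{K}\to W$ with $f(x+tv)-f(x)=t\,f^{[1]}(x,v,t)$ for all $x,v,t$. A $C^1_{\mathbb{K}}$-law from $V$ to $W$ over $f$ is given by $f$ together with a difference factorizer $f^{[1]}$ satisfying, for all $x,v,v'\in V$, $s,t\in\mathbb{K}$, $f^{[1]}(x,v+v',t)=f^{[1]}(x+tv,v',t)+f^{[1]}(x,v,t)$ and $f^{[1]}(x,sv,t)=s\,f^{[1]}(x,v,st)$.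 It is encoded by the map $f^{\overline{\{1\}}}(x,v;s,t)=(f(x),f^{[1]}(x,v,st);s,t)$ (equivalently: a morphism, trivial on $\mathbb{K}$, of the canonical double categories of $V$ and $W$). Its tangent map is $V\times V\to W\times W$, $(x,v)\mapsto(f(x),f^{[1]}(x,v,0))$, where $TV:=V\times V$, and its differential at $x$ is $v\mapsto f^{[1]}(x,v,0)$. *)

(* Defs.v *)
From HB Require Import structures.
From mathcomp Require Import all_boot all_algebra boolp.

Set Implicit Arguments.
Unset Strict Implicit.
Unset Printing Implicit Defensive.

Import GRing.Theory.
Local Open Scope ring_scope.
Local Open Scope quotient_scope.

(* The tensor product of two K-modules: formal sums of pairs (v, w), read as
   v_1 (x) w_1 + ... + v_n (x) w_n, modulo the congruence generated by
   commutativity of the formal sum and the bilinearity relations. *)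
Section TensorRelation.
Variables (K : comNzRingType) (V W : lmodType K).

Inductive tens_rel : seq (V * W) -> seq (V * W) -> Prop :=
| tens_refl s : tens_rel s s
| tens_sym s t : tens_rel s t -> tens_rel t s
| tens_trans s t u : tens_rel s t -> tens_rel t u -> tens_rel s u
| tens_cat s s' t t' :
    tens_rel s s' -> tens_rel t t' -> tens_rel (s ++ t) (s' ++ t')
| tens_catC s t : tens_rel (s ++ t) (t ++ s)
| tens_0l w : tens_rel [:: (0, w)] [::]
| tens_Dl v v' w : tens_rel [:: (v + v', w)] [:: (v, w); (v', w)]
| tens_Dr v w w' : tens_rel [:: (v, w + w')] [:: (v, w); (v, w')]
| tens_Z a v w : tens_rel [:: (a *: v, w)] [:: (v, a *: w)].

Definition tens_eqv (s t : seq (V * W)) : bool := `[< tens_rel s t >].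

Fact tens_eqv_refl : reflexive tens_eqv.
Proof. by move=> s; apply/asboolP/tens_refl. Qed.

Fact tens_eqv_sym : symmetric tens_eqv.
Proof. by move=> s t; apply/asboolP/asboolP => /tens_sym. Qed.

Fact tens_eqv_trans : transitive tens_eqv.
Proof.
move=> t s u /asboolP st /asboolP tu; apply/asboolP; exact: tens_trans st tu.
Qed.

Canonical tens_eqv_equiv :=
  EquivRel tens_eqv tens_eqv_refl tens_eqv_sym tens_eqv_trans.

Definition tens := {eq_quot tens_eqv}.

HB.instance Definition _ : EqQuotient _ tens_eqv tens := EqQuotient.on tens.
HB.instance Definition _ := Choice.on tens.

Lemma tens_eqP (s t : seq (V * W)) :
  (\pi_tens s = \pi_tens t) <-> tens_rel s t.
Proof.
by split=> [/eqP|st]; [rewrite eqmodE => /asboolP|apply/eqmodP/asboolP].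
Qed.

Lemma tens_repr (s : seq (V * W)) : tens_rel (repr (\pi_tens s)) s.
Proof. by apply/tens_eqP; rewrite reprK. Qed.

Definition tens_add (x y : tens) : tens := \pi_tens (repr x ++ repr y).
Definition tens_opp (x : tens) : tens :=
  \pi_tens [seq (- p.1, p.2) | p <- repr x].
Definition tens_scale (a : K) (x : tens) : tens :=
  \pi_tens [seq (a *: p.1, p.2) | p <- repr x].
Definition tensor (v : V) (w : W) : tens := \pi_tens [:: (v, w)].

Lemma tens_rel_mapl (f : V -> V) (fD : {morph f : x y / x + y})
    (fZ : forall a, {morph f : x / a *: x}) s t : tens_rel s t ->
  tens_rel [seq (f p.1, p.2) | p <- s] [seq (f p.1, p.2) | p <- t].
Proof.
have f0 : f 0 = 0 by have := fZ 0 0; rewrite !scale0r.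
elim=> {s t} [s|s t _|s t u _ st _|s s' t t' _ ss _ tt|s t|w|v v' w|v w w'|a v w].
- exact: tens_refl.
- exact: tens_sym.
- exact: tens_trans.
- by rewrite !map_cat; apply: tens_cat; [exact: ss|exact: tt].
- by rewrite !map_cat; apply: tens_catC.
- by rewrite /= f0; apply: tens_0l.
- by rewrite /= fD; apply: tens_Dl.
- exact: tens_Dr.
- by rewrite /= fZ; apply: tens_Z.
Qed.

Lemma tens_addE s t : tens_add (\pi s) (\pi t) = \pi_tens (s ++ t).
Proof. by apply/tens_eqP; apply: tens_cat; apply: tens_repr. Qed.

Lemma tens_oppE s : tens_opp (\pi s) = \pi_tens [seq (- p.1, p.2) | p <- s].
Proof.
apply/tens_eqP; apply: (@tens_rel_mapl -%R); last exact: tens_repr.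
  by move=> x y; rewrite opprD.
by move=> a x; rewrite scalerN.
Qed.

Lemma tens_scaleE a s :
  tens_scale a (\pi s) = \pi_tens [seq (a *: p.1, p.2) | p <- s].
Proof.
apply/tens_eqP; apply: (@tens_rel_mapl ( *:%R a)); last exact: tens_repr.
  by move=> x y; rewrite scalerDr.
by move=> b x; rewrite !scalerA mulrC.
Qed.

Fact tens_addA : associative tens_add.
Proof.
by elim/quotW=> s; elim/quotW=> t; elim/quotW=> u; rewrite !tens_addE catA.
Qed.

Fact tens_addC : commutative tens_add.
Proof.
elim/quotW=> s; elim/quotW=> t; rewrite !tens_addE.
by apply/tens_eqP/tens_catC.
Qed.

Fact tens_add0 : left_id (\pi_tens [::]) tens_add.
Proof. by elim/quotW=> s; rewrite tens_addE. Qed.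

Fact tens_addN : left_inverse (\pi_tens [::]) tens_opp tens_add.
Proof.
elim/quotW=> s; rewrite tens_oppE tens_addE; apply/tens_eqP.
elim: s => [|[v w] s IHs] /=; first exact: tens_refl.
rewrite -[_ :: _]/([:: (- v, w)] ++ _) -[(v, w) :: s]/([:: (v, w)] ++ s).
have vw : tens_rel ([:: (- v, w)] ++ [:: (v, w)]) [::].
  apply: tens_trans (tens_0l w); rewrite -(addNr v).
  by apply/tens_sym/tens_Dl.
apply: (@tens_trans _ (([:: (- v, w)] ++ [:: (v, w)]) ++
    ([seq (- p.1, p.2) | p <- s] ++ s))); last exact: tens_cat vw IHs.
rewrite -!catA; apply: tens_cat; first exact: tens_refl.
rewrite !catA; apply: tens_cat; last exact: tens_refl.
exact: tens_catC.
Qed.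

HB.instance Definition _ :=
  GRing.isZmodule.Build tens tens_addA tens_addC tens_add0 tens_addN.

Lemma piD s t : \pi_tens (s ++ t) = \pi_tens s + \pi_tens t.
Proof. by rewrite [RHS]tens_addE. Qed.

Lemma pi_cons v w s : \pi_tens ((v, w) :: s) = tensor v w + \pi_tens s.
Proof. by rewrite -piD. Qed.

Lemma pi_nil : \pi_tens [::] = 0 :> tens. Proof. by []. Qed.

Fact tens_scaleA a b x : tens_scale a (tens_scale b x) = tens_scale (a * b) x.
Proof.
elim/quotW: x => s; rewrite !tens_scaleE -map_comp; congr (\pi_tens _).
by apply: eq_map => -[v w] /=; rewrite scalerA.
Qed.

Fact tens_scale1 : left_id 1 tens_scale.
Proof.
elim/quotW=> s; rewrite tens_scaleE; congr (\pi_tens _).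
by rewrite -[RHS]map_id; apply: eq_map => -[v w] /=; rewrite scale1r.
Qed.

Fact tens_scaleDr : right_distributive tens_scale +%R.
Proof.
move=> a; elim/quotW=> s; elim/quotW=> t.
by rewrite -piD !tens_scaleE map_cat piD.
Qed.

Fact tens_scaleDl x : {morph tens_scale^~ x : a b / a + b}.
Proof.
move=> a b; elim/quotW: x => s; rewrite !tens_scaleE.
elim: s => [|[v w] s IHs] /=; first by rewrite pi_nil addr0.
rewrite !pi_cons IHs addrACA; congr (_ + _).
by rewrite /tensor -piD scalerDl; apply/tens_eqP/tens_Dl.
Qed.

HB.instance Definition _ := GRing.Zmodule_isLmodule.Build K tens
  tens_scaleA tens_scale1 tens_scaleDr tens_scaleDl.

Lemma tensorDl v v' w : tensor (v + v') w = tensor v w + tensor v' w.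
Proof. by rewrite /tensor -piD; apply/tens_eqP/tens_Dl. Qed.

Lemma tensorDr v w w' : tensor v (w + w') = tensor v w + tensor v w'.
Proof. by rewrite /tensor -piD; apply/tens_eqP/tens_Dr. Qed.

Lemma tensorZl a v w : tensor (a *: v) w = a *: tensor v w.
Proof. by rewrite [RHS]tens_scaleE. Qed.

Lemma tensorZr a v w : tensor v (a *: w) = a *: tensor v w.
Proof. by rewrite -tensorZl; apply/esym/tens_eqP/tens_Z. Qed.

Lemma tensor0l w : tensor 0 w = 0.
Proof. by have := tensorZl 0 0 w; rewrite !scale0r. Qed.

Lemma tensor_bilinear : bilinear_for *:%R *:%R tensor.
Proof.
by split=> [w a v v'|v a w w']; rewrite ?tensorDl ?tensorZl ?tensorDr ?tensorZr.
Qed.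

Lemma tens_ind (Q : tens -> Prop) :
  Q 0 -> (forall v w x, Q x -> Q (tensor v w + x)) -> forall x, Q x.
Proof.
move=> Q0 QD; elim/quotW; elim=> [|[v w] s IHs]; first by rewrite pi_nil.
by rewrite pi_cons; apply: QD.
Qed.

(* The linear map V (x) W -> M induced by f; meaningful only for f bilinear,
   see tens_lift_linear, tens_liftE and tens_lift_unique. *)
Definition tens_lift (M : lmodType K) (f : V -> W -> M) (x : tens) : M :=
  \sum_(p <- repr x) f p.1 p.2.

Section Lift.
Variables (M : lmodType K) (f : V -> W -> M).
Hypothesis f_bilin : bilinear_for *:%R *:%R f.

Let f_linl w : linear (f^~ w) := f_bilin.1 w.
Let f_linr v : linear (f v) := f_bilin.2 v.

Lemma tens_lift_pi s : tens_lift f (\pi s) = \sum_(p <- s) f p.1 p.2.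
Proof.
have fDl w v v' : f (v + v') w = f v w + f v' w.
  by have := f_linl w 1 v v'; rewrite !scale1r.
have fDr v w w' : f v (w + w') = f v w + f v w'.
  by have := f_linr v 1 w w'; rewrite !scale1r.
have f0l w : f 0 w = 0 by apply: (addrI (f 0 w)); rewrite -fDl !addr0.
have f0r v : f v 0 = 0 by apply: (addrI (f v 0)); rewrite -fDr !addr0.
suff rel_sum t u : tens_rel t u ->
    \sum_(p <- t) f p.1 p.2 = \sum_(p <- u) f p.1 p.2.
  exact: rel_sum (tens_repr s).
elim=> {s t u}
  [//|s t _ -> //|s t u _ -> _ -> //|s s' t t' _ ss _ tt|s t|w|v v' w|v w w'|a v w].
- by rewrite !big_cat /= ss tt.
- by rewrite !big_cat /= addrC.
- by rewrite big_seq1 big_nil f0l.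
- by rewrite big_seq1 big_cons big_seq1 fDl.
- by rewrite big_seq1 big_cons big_seq1 fDr.
- rewrite !big_seq1 /= -[a *: v]addr0 -[a *: w]addr0.
  by rewrite (f_linl w a) (f_linr v a) f0l f0r.
Qed.

Lemma tens_liftE v w : tens_lift f (tensor v w) = f v w.
Proof. by rewrite tens_lift_pi big_seq1. Qed.

Lemma tens_lift0 : tens_lift f 0 = 0.
Proof. by rewrite -pi_nil tens_lift_pi big_nil. Qed.

Lemma tens_liftD x y : tens_lift f (x + y) = tens_lift f x + tens_lift f y.
Proof.
elim/quotW: x => s; elim/quotW: y => t.
by rewrite -piD !tens_lift_pi big_cat.
Qed.

Lemma tens_lift_linear : linear (tens_lift f).
Proof.
move=> a x y; rewrite tens_liftD; congr (_ + _).
elim/quotW: x => s; rewrite [a *: _]tens_scaleE !tens_lift_pi big_map.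
rewrite scaler_sumr; apply: eq_bigr => -[v w] _ /=.
have f0 : f 0 w = 0.
  by have := f_linl w 1 0 0; rewrite !scale1r addr0 -[LHS]addr0 => /addrI.
by rewrite -[a *: v]addr0 (f_linl w a) f0 addr0.
Qed.

Lemma tens_lift_unique (g : tens -> M) : linear g ->
  (forall v w, g (tensor v w) = f v w) -> g =1 tens_lift f.
Proof.
move=> glin gE.
have gD x y : g (x + y) = g x + g y.
  by have := glin 1 x y; rewrite !scale1r.
have g0 : g 0 = 0 by apply: (addrI (g 0)); rewrite -gD !addr0.
elim/tens_ind=> [|v w x IHx]; first by rewrite g0 tens_lift0.
by rewrite gD tens_liftD gE tens_liftE IHx.
Qed.

End Lift.

End TensorRelation.

Arguments tensor {K V W} v w.
Notation "v '\ox' w" := (tensor v w) (at level 40, left associativity) : ring_scope.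

Section ScalarExtension.
Variables (K : comNzRingType) (V : lmodType K).

Definition scalar_ext (A : comAlgType K) : lmodType K := tens V A.

(* id (x) phi : V_A -> V_B *)
Definition scalar_ext_map (A B : comAlgType K) (phi : {lrmorphism A -> B}) :
    scalar_ext A -> scalar_ext B :=
  tens_lift (fun v a => v \ox phi a).

Lemma scalar_ext_mapE (A B : comAlgType K) (phi : {lrmorphism A -> B}) v a :
  scalar_ext_map phi (v \ox a) = v \ox phi a.
Proof.
rewrite [LHS]tens_liftE //; split=> [b c x y|x c b b'].
  by rewrite tensorDl tensorZl.
by rewrite linearP tensorDr tensorZr.
Qed.

(* V_K is identified with V via x <-> x (x) 1. *)
Definition ext_base (x : V) : scalar_ext K^o := x \ox (1 : K^o).
Definition base_of_ext : scalar_ext K^o -> V :=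
  tens_lift (fun x (a : K^o) => (a : K) *: x).

Fact base_of_ext_bilinear :
  bilinear_for *:%R *:%R (fun (x : V) (a : K^o) => (a : K) *: x).
Proof.
split=> [a c x y|x c a b] /=; first by rewrite scalerDr !scalerA mulrC.
by rewrite scalerDl scalerA.
Qed.

Lemma ext_baseK : cancel ext_base base_of_ext.
Proof.
move=> x; rewrite /base_of_ext tens_liftE ?scale1r //.
exact: base_of_ext_bilinear.
Qed.

Lemma base_of_extK : cancel base_of_ext ext_base.
Proof.
have bil := base_of_ext_bilinear; rewrite /base_of_ext /ext_base.
elim/tens_ind=> [|x a z IHz]; first by rewrite (tens_lift0 bil) tensor0l.
rewrite (tens_liftD bil) (tens_liftE bil).
by rewrite tensorDl IHz tensorZl -tensorZr [_%:A]mulr1.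
Qed.

(* V (x) K[X]/(p), with p monic of degree 2, is identified with V * V via
   (x, v) <-> x (x) [1] + v (x) [X]; elements of {poly %/ p} are represented
   by their remainders modulo p. *)
Section Quadratic.
Variable p : {poly K}.

Definition ext_pair (u : V * V) : scalar_ext {poly %/ p} :=
  u.1 \ox (1 : {poly %/ p}) + u.2 \ox ('qX : {poly %/ p}).

Definition pair_of_ext (z : scalar_ext {poly %/ p}) : V * V :=
  (tens_lift (fun x (a : {poly %/ p}) => (a : {poly K})`_0 *: x) z,
   tens_lift (fun x (a : {poly %/ p}) => (a : {poly K})`_1 *: x) z).

Fact coef_bilinear i : bilinear_for *:%R *:%R
  (fun (x : V) (a : {poly %/ p}) => (a : {poly K})`_i *: x).
Proof.
split=> [a c x y|x c a b] /=; first by rewrite scalerDr !scalerA mulrC.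
by rewrite coefD coefZ scalerDl scalerA.
Qed.

Hypotheses (p_monic : p \is monic) (p_size : size p = 3%N).

Lemma qpoly2E (a : {poly %/ p}) :
  a = (a : {poly K})`_0 *: 1 + (a : {poly K})`_1 *: 'qX.
Proof.
have qXE : ('qX : {poly %/ p}) = 'X :> {poly K} by rewrite qpolyXE ?p_size.
apply: val_inj; apply/polyP => i.
transitivity ((a : {poly K})`_0 *: 1
  + (a : {poly K})`_1 *: (('qX : {poly %/ p}) : {poly K}))`_i; last by [].
rewrite qXE.
have sa : (size (a : {poly K}) <= 2)%N.
  have mkp : size (mk_monic p) = 3%N by rewrite /mk_monic p_size p_monic.
  by rewrite -ltnS -mkp size_mk_monic.
rewrite coefD !coefZ coefX coef1.
case: i => [|[|i]]; rewrite ?mulr1 ?mulr0 ?addr0 ?add0r //.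
by rewrite nth_default // (leq_trans sa).
Qed.

Lemma ext_pairK : cancel ext_pair pair_of_ext.
Proof.
case=> x v; rewrite /pair_of_ext /ext_pair.
have bil := coef_bilinear.
rewrite !(tens_liftD (bil _)) !(tens_liftE (bil _)) qpolyXE ?p_size //=.
by rewrite !coefX !coefC /= !scale1r !scale0r addr0 add0r.
Qed.

Lemma pair_of_extK : cancel pair_of_ext ext_pair.
Proof.
have bil := coef_bilinear.
rewrite /pair_of_ext /ext_pair /=; elim/tens_ind=> [|x a z IHz].
  by rewrite !(tens_lift0 (bil _)) !tensor0l addr0.
rewrite !(tens_liftD (bil _)) !(tens_liftE (bil _)) !tensorDl addrACA IHz.
by congr (_ + _); rewrite !tensorZl -!tensorZr -tensorDr -qpoly2E.
Qed.

End Quadratic.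

End ScalarExtension.

(* comAlgType K only contains nonzero algebras; over the zero algebra the
   scalar extension is trivial, so a polynomial law has exactly one component
   there and it is automatically natural. *)
Record polylaw (K : comNzRingType) (V W : lmodType K) := PolyLaw {
  polylaw_fun :> forall A : comAlgType K, scalar_ext V A -> scalar_ext W A;
  polylaw_natural : forall (A B : comAlgType K) (phi : {lrmorphism A -> B}),
    @polylaw_fun B \o scalar_ext_map phi =1 scalar_ext_map phi \o @polylaw_fun A
}.
Arguments polylaw_fun {K V W} p A _.

Section PolyLawMaps.
Variables (K : comNzRingType) (V W : lmodType K) (P : polylaw V W).

Definition polylaw_base (x : V) : W := base_of_ext (P K^o (ext_base x)).

Definition polylaw_quad (p : {poly K}) (u : V * V) : W * W :=
  pair_of_ext (P {poly %/ p} (ext_pair p u)).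

Definition polylaw_at (r : K) : V * V -> W * W :=
  polylaw_quad ('X^2 - r *: 'X).

End PolyLawMaps.

Lemma XsubrX_monic_size (K : comNzRingType) (r : K) :
  ('X^2 - r *: 'X \is monic) /\ size ('X^2 - r *: 'X) = 3%N.
Proof.
have szN : (size (- (r *: 'X) : {poly K}) < size ('X^2 : {poly K}))%N.
  rewrite size_polyN size_polyXn (leq_ltn_trans (size_scale_leq _ _)) //.
  by rewrite size_polyX.
by rewrite monicE lead_coefDl // size_polyDl // lead_coefXn size_polyXn eqxx.
Qed.

Section C1Laws.
Variables (K : comNzRingType) (V W : lmodType K).

Definition difference_factorizer (f : V -> W) (f1 : V -> V -> K -> W) :=
  forall x v t, f (x + t *: v) - f x = t *: f1 x v t.

Record C1law (f : V -> W) := C1Law {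
  C1slope : V -> V -> K -> W;
  C1slopeP : difference_factorizer f C1slope;
  C1slopeD : forall x v v' t,
    C1slope x (v + v') t = C1slope (x + t *: v) v' t + C1slope x v t;
  C1slopeZ : forall x v s t, C1slope x (s *: v) t = s *: C1slope x v (s * t)
}.

Definition C1map f (F : C1law f) (z : (V * V) * (K * K)) :
    (W * W) * (K * K) :=
  let: ((x, v), (s, t)) := z in ((f x, C1slope F x v (s * t)), (s, t)).

Definition C1tangent f (F : C1law f) (u : V * V) : W * W :=
  (f u.1, C1slope F u.1 u.2 0).

Definition C1differential f (F : C1law f) (x v : V) : W := C1slope F x v 0.

End C1Laws.

(* Main.v *)
(* Naturality along K[X]/(X^2-rX) -> C, X |-> y, for suitable y in C with
   y^2 = ry: X |-> 0 and X |-> r give the source and target of an arrow, hence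
   the difference factorizer; X |-> sX gives homogeneity.  Additivity comes from
   the algebra of pairs of composable arrows, which maps to K[X]/(X^2-tX) by both
   projections and by composition. *)
From HB Require Import structures.
Require Import Defs.
From mathcomp Require Import all_boot all_algebra ring.
Import GRing.Theory.
Local Open Scope ring_scope.

Set Implicit Arguments.
Unset Strict Implicit.
Unset Printing Implicit Defensive.

(** * Arithmetic in K[X]/(X^2-rX) and the algebra morphisms out of it *)

Section QuadEval.
Variables (K : comNzRingType) (r : K).
Local Notation p := ('X^2 - r *: 'X).

Lemma qpolyX_quad : 'qX * 'qX = r *: 'qX :> {poly %/ p}.
Proof.
have [p_monic p_size] := XsubrX_monic_size r.
(* The quotient reduces modulo [mk_monic p], which falls back on a default unless [p] is monic and
   nonconstant. *)
have mkp : mk_monic p = p by rewrite /mk_monic p_size p_monic.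
(* The difference of the two sides is the class of [p] itself, whose remainder modulo [p] is 0. *)
rewrite /qpolyX -in_qpolyM -in_qpolyZ; apply/eqP.
rewrite -subr_eq0 -linearB /= -expr2; apply/eqP/val_inj.
by rewrite /= mkp Pdiv.RingMonic.rmodpp.
Qed.

Lemma quad_coef (c d : K) (a : {poly %/ p}) : a = c *: 1 + d *: 'qX ->
  (a : {poly K})`_0 = c /\ (a : {poly K})`_1 = d.
Proof.
have [p_monic p_size] := XsubrX_monic_size r.
have qXE : ('qX : {poly %/ p}) = 'X :> {poly K} by rewrite qpolyXE ?p_size.
move=> ->; rewrite poly_of_qpolyD !poly_of_qpolyZ qXE.
by rewrite !coefD !coefZ !coefX !coefC /= !mulr1 !mulr0 addr0 add0r.
Qed.

Lemma quad_coefM (a b : {poly %/ p}) :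
  let a0 := (a : {poly K})`_0 in let a1 := (a : {poly K})`_1 in
  let b0 := (b : {poly K})`_0 in let b1 := (b : {poly K})`_1 in
  ((a * b : {poly %/ p}) : {poly K})`_0 = a0 * b0 /\
  ((a * b : {poly %/ p}) : {poly K})`_1 = a0 * b1 + a1 * b0 + r * a1 * b1.
Proof.
move=> a0 a1 b0 b1; have [p_monic p_size] := XsubrX_monic_size r.
apply: quad_coef; rewrite {1}(qpoly2E p_monic p_size a).
rewrite {1}(qpoly2E p_monic p_size b) -/a0 -/a1 -/b0 -/b1.
rewrite mulrDl !mulrDr -!scalerAl !mul1r -!scalerAr mulr1 qpolyX_quad.
rewrite !scalerA !scalerDl !addrA; congr (_ + _ + _ + _ *: _).
by rewrite mulrC mulrA.
Qed.

Variables (C : comAlgType K) (y : C).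

(** The morphism X |-> y. The relation is an argument so that the term carries the proof from which
    its algebra morphism structure is inferred. *)
Definition quad_eval of y * y = r *: y := fun a : {poly %/ p} =>
  (a : {poly K})`_0 *: 1 + (a : {poly K})`_1 *: y.

Hypothesis yy : y * y = r *: y.

Fact quad_eval_linear : linear (quad_eval yy).
Proof.
move=> c a b; rewrite /quad_eval !poly_of_qpolyD !poly_of_qpolyZ !coefD !coefZ.
by rewrite !scalerDl scalerDr !scalerA addrACA.
Qed.
HB.instance Definition _ :=
  GRing.isLinear.Build K {poly %/ p} C _ (quad_eval yy) quad_eval_linear.

Fact quad_eval_multiplicative : monoid_morphism (quad_eval yy).
Proof.
split=> [|a b]; first by rewrite /quad_eval !coefC /= scale1r scale0r addr0.
rewrite /quad_eval; have [-> ->] := quad_coefM a b.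
rewrite mulrDl !mulrDr -!scalerAl !mul1r -!scalerAr mulr1 yy.
rewrite !scalerA !scalerDl !addrA; congr (_ + _ + _ + _ *: _).
by rewrite -mulrA mulrC.
Qed.
HB.instance Definition _ :=
  GRing.isMonoidMorphism.Build {poly %/ p} C (quad_eval yy)
    quad_eval_multiplicative.

Lemma quad_evalX : quad_eval yy 'qX = y.
Proof.
rewrite /quad_eval; have [|-> ->] := @quad_coef 0 1 ('qX : {poly %/ p}).
  by rewrite scale0r add0r scale1r.
by rewrite scale0r add0r scale1r.
Qed.

End QuadEval.

(* The fibre product {(p, q) | p(t) = q(0)} of two copies of K[X]/(X^2-tX), in
   coordinates on the basis (1, 1), (X, t), (0, X); the products of the last two
   basis vectors X1, X2 are X1^2 = tX1, X2^2 = tX2 and X1X2 = tX2. *)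
Definition compalg (K : comNzRingType) (t : K) : Type := (K^o * K^o * K^o)%type.

(** * The algebra of composable pairs of arrows and its universal property *)

Section CompAlg.
Variables (K : comNzRingType) (t : K).
Local Notation B := (compalg t).

HB.instance Definition _ := GRing.Lmodule.copy B (K^o * K^o * K^o)%type.

Definition comp_one : B := (1, 0, 0).
Definition comp_mul (a b : B) : B :=
  (a.1.1 * b.1.1,
   a.1.1 * b.1.2 + a.1.2 * b.1.1 + t * a.1.2 * b.1.2,
   a.1.1 * b.2 + a.2 * b.1.1 + t * a.1.2 * b.2 + t * a.2 * b.1.2
     + t * a.2 * b.2).

Fact comp_mulA : associative comp_mul.
Proof.
by move=> [[a b] c] [[d e] f] [[g h] i]; congr (_, _, _) => /=; ring.
Qed.

Fact comp_mulC : commutative comp_mul.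
Proof. by move=> [[a b] c] [[d e] f]; congr (_, _, _) => /=; ring. Qed.

Fact comp_mul1 : left_id comp_one comp_mul.
Proof. by move=> [[a b] c]; congr (_, _, _) => /=; ring. Qed.

Fact comp_mulDl : left_distributive comp_mul +%R.
Proof.
by move=> [[a b] c] [[d e] f] [[g h] i]; congr (_, _, _) => /=; ring.
Qed.

Fact comp_one_neq0 : comp_one != 0.
Proof. by apply/eqP => -[/eqP]; rewrite oner_eq0. Qed.

HB.instance Definition _ := GRing.Zmodule_isComNzRing.Build B
  comp_mulA comp_mulC comp_mul1 comp_mulDl comp_one_neq0.

(* Without the cast, k *: a is read in K^o * K^o * K^o, whose canonical product
   is componentwise. *)
Fact comp_scaleAl (k : K) (a b : B) : k *: (a * b) = (k *: a : B) * b.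
Proof.
by case: a b => [[a b] c] [[d e] f]; congr (_, _, _) => /=;
  rewrite /GRing.scale /=; ring.
Qed.

HB.instance Definition _ := GRing.Lmodule_isLalgebra.Build K B comp_scaleAl.
HB.instance Definition _ := GRing.Lalgebra_isComAlgebra.Build K B.

Definition comp_fst : B := (0, 1, 0).
Definition comp_snd : B := (0, 0, 1).

Lemma compE (a : B) :
  a = a.1.1 *: (1 : B) + a.1.2 *: comp_fst + a.2 *: comp_snd.
Proof.
case: a => [[a b] c]; congr (_, _, _); rewrite /= !scaler0 ?addr0 ?add0r;
  exact: (esym (mulr1 _)).
Qed.

Variables (C : comAlgType K) (y y' : C).

Definition comp_eval of y * y = t *: y & y' * y' = t *: y' & y * y' = t *: y' :=
  fun a : B => a.1.1 *: 1 + a.1.2 *: y + a.2 *: y'.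

Hypotheses (yy : y * y = t *: y) (y'y' : y' * y' = t *: y')
  (yy' : y * y' = t *: y').

Local Notation ev := (comp_eval yy y'y' yy').

Fact comp_eval_linear : linear ev.
Proof.
move=> c a b; rewrite /comp_eval /= !scalerDl !scalerDr !scalerA.
by rewrite [RHS]addrACA; congr (_ + _); exact: addrACA.
Qed.
HB.instance Definition _ := GRing.isLinear.Build K B C _ ev comp_eval_linear.

Fact comp_eval_multiplicative : monoid_morphism ev.
Proof.
split=> [|a b]; first by rewrite /comp_eval /= scale1r !scale0r !addr0.
rewrite /comp_eval /=.
(* Scalars become ring elements through [in_alg], so that [ring] can compute modulo the three
   relations. *)
have sE (k : K) (z : C) : k *: z = in_alg C k * z by rewrite mulr_algl.
move: yy y'y' yy'; rewrite !sE => h1 h2 h3.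
by ring: h1 h2 h3.
Qed.
HB.instance Definition _ :=
  GRing.isMonoidMorphism.Build B C ev comp_eval_multiplicative.

Lemma comp_eval_fst : ev comp_fst = y.
Proof. by rewrite /comp_eval /= scale1r !scale0r add0r addr0. Qed.

Lemma comp_eval_snd : ev comp_snd = y'.
Proof. by rewrite /comp_eval /= scale1r !scale0r !add0r. Qed.

End CompAlg.

(** * Consequences of naturality for [polylaw_at] *)

Section PolyLawAt.
Variables (K : comNzRingType) (V W : lmodType K) (P : polylaw V W).

Lemma tensor0r (U M : lmodType K) (u : U) : u \ox (0 : M) = 0.
Proof. by have := tensorZr 0 u (0 : M); rewrite !scale0r. Qed.

Lemma scalar_ext_mapD (U : lmodType K) (A B : comAlgType K)
    (phi : {lrmorphism A -> B}) (z z' : scalar_ext U A) :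
  scalar_ext_map phi (z + z') = scalar_ext_map phi z + scalar_ext_map phi z'.
Proof.
apply: tens_liftD; split=> [b c x y|x c b b'].
  by rewrite tensorDl tensorZl.
by rewrite linearP tensorDr tensorZr.
Qed.

(** Naturality along X |-> y: this morphism sends the element encoding (x, v) to x (x) 1 + v (x) y,
    and likewise on the side of W. *)
Lemma polylaw_at_eval (r : K) (C : comAlgType K) (y : C) (x v : V) :
    y * y = r *: y ->
  P C (x \ox (1 : C) + v \ox y) =
    (polylaw_at P r (x, v)).1 \ox (1 : C) + (polylaw_at P r (x, v)).2 \ox y.
Proof.
move=> yy; set w := polylaw_at P r (x, v).
have [p_monic p_size] := XsubrX_monic_size r.
have evE (U : lmodType K) (u : U * U) :
    scalar_ext_map (quad_eval yy) (ext_pair _ u) = u.1 \ox (1 : C) + u.2 \ox y.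
  by rewrite scalar_ext_mapD !scalar_ext_mapE rmorph1 /= quad_evalX.
rewrite -(evE _ (x, v)) -(evE _ w) [LHS]polylaw_natural /= /w /polylaw_at.
by rewrite /polylaw_quad pair_of_extK.
Qed.

Lemma polylaw_at_eq (r : K) (x v : V) (a b : W) :
  P {poly %/ ('X^2 - r *: 'X)} (ext_pair _ (x, v)) = ext_pair _ (a, b) ->
  polylaw_at P r (x, v) = (a, b).
Proof.
have [p_monic p_size] := XsubrX_monic_size r.
by rewrite /polylaw_at /polylaw_quad => ->; rewrite ext_pairK.
Qed.

Lemma ext_base_comb (U : lmodType K) (x v : U) (r : K) :
  x \ox (1 : K^o) + v \ox (r : K^o) = ext_base (x + r *: v).
Proof.
by rewrite /ext_base tensorDl tensorZl -tensorZr [r%:A]mulr1.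
Qed.

Lemma polylaw_at_target (r : K) (x v : V) :
  polylaw_base P (x + r *: v) =
    (polylaw_at P r (x, v)).1 + r *: (polylaw_at P r (x, v)).2.
Proof.
have := @polylaw_at_eval r K^o r x v erefl.
by rewrite !ext_base_comb /polylaw_base => ->; rewrite ext_baseK.
Qed.

Lemma polylaw_at_source (r : K) (x v : V) :
  (polylaw_at P r (x, v)).1 = polylaw_base P x.
Proof.
have := @polylaw_at_eval r K^o 0 x v.
rewrite mulr0 scaler0 => /(_ erefl).
rewrite !ext_base_comb /polylaw_base !scale0r !addr0 => ->.
by rewrite ext_baseK.
Qed.

(** In K[X]/(X^2-tX) the element y = sX satisfies y^2 = (st)y, and v (x) sX = sv (x) X. *)
Lemma polylaw_at_scale (x v : V) (s t : K) :
  (polylaw_at P t (x, s *: v)).2 = s *: (polylaw_at P (s * t) (x, v)).2.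
Proof.
have := @polylaw_at_eval (s * t) {poly %/ ('X^2 - t *: 'X)} (s *: 'qX) x v.
rewrite -scalerAl -scalerAr qpolyX_quad !scalerA mulrAC.
move=> /(_ erefl); rewrite !tensorZr -!tensorZl.
by move=> /(@polylaw_at_eq t x (s *: v) _ (s *: _)) ->.
Qed.

(** The coordinates a, b, c are read off once, over [compalg t]; naturality along [comp_eval]
    transports them to every C. *)
Lemma polylaw_comp (t : K) (x v v' : V) : exists a b c : W,
  forall (C : comAlgType K) (y y' : C),
    y * y = t *: y -> y' * y' = t *: y' -> y * y' = t *: y' ->
  P C (x \ox (1 : C) + v \ox y + v' \ox y') =
    a \ox (1 : C) + b \ox y + c \ox y'.
Proof.
pose e (U : lmodType K) (x v v' : U) (C : comAlgType K) (y y' : C) :=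
  x \ox (1 : C) + v \ox y + v' \ox y'.
have [a [b [c abc]]] : exists a b c : W,
    P (compalg t) (e V x v v' _ (comp_fst t) (comp_snd t)) =
      e W a b c _ (comp_fst t) (comp_snd t).
  (* The value of [P] is generalised: any tensor over [compalg t] has this form, by expanding its
     right factors with [compE]. *)
  elim/tens_ind: (P _ _) => [|w d z [a [b [c ->]]]].
    by exists 0, 0, 0; rewrite /e !tensor0l !addr0.
  exists (d.1.1 *: w + a), (d.1.2 *: w + b), (d.2 *: w + c).
  rewrite /e !tensorDl !tensorZl [in LHS](compE d) !tensorDr !tensorZr.
  by rewrite [LHS]addrACA; congr (_ + _); exact: addrACA.
exists a, b, c => C y y' yy y'y' yy'.
have evE (U : lmodType K) (u1 u2 u3 : U) :
    scalar_ext_map (comp_eval yy y'y' yy' : {lrmorphism compalg t -> C})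
      (e U u1 u2 u3 _ (comp_fst t) (comp_snd t)) = e U u1 u2 u3 C y y'.
  rewrite !scalar_ext_mapD !scalar_ext_mapE rmorph1 /=.
  by rewrite comp_eval_fst comp_eval_snd.
rewrite -/(e V x v v' C y y') -/(e W a b c C y y') -!evE -abc.
exact: polylaw_natural.
Qed.

(** The same a, b, c serve three choices of (y, y') in K[X]/(X^2-tX): (X, 0) is the first arrow, (t,
    X) the second, starting at x + tv, and (X, X) their composite, whose slope is therefore b +
    c. *)
Lemma polylaw_at_add (x v v' : V) (t : K) :
  (polylaw_at P t (x, v + v')).2 =
    (polylaw_at P t (x + t *: v, v')).2 + (polylaw_at P t (x, v)).2.
Proof.
have [a [b [c abc]]] := polylaw_comp t x v v'.
pose A : comAlgType K := {poly %/ ('X^2 - t *: 'X)}.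
pose X : A := 'qX.
have XX : X * X = t *: X by apply: qpolyX_quad.
have -> : polylaw_at P t (x, v) = (a, b).
  apply: polylaw_at_eq; have := abc A X 0 XX.
  by rewrite !mulr0 !scaler0 !tensor0r !addr0; apply.
have -> : polylaw_at P t (x + t *: v, v') = (a + t *: b, c).
  apply: polylaw_at_eq; have := abc A (t *: 1) X.
  rewrite -!scalerAl !mul1r XX => /(_ erefl erefl erefl).
  by rewrite !tensorZr -!tensorZl -!tensorDl.
have -> : polylaw_at P t (x, v + v') = (a, b + c).
  apply: polylaw_at_eq; have := abc A X X XX XX XX.
  by rewrite -!addrA -!tensorDl.
by rewrite addrC.
Qed.

End PolyLawAt.

Theorem theorem4p15 (K : comNzRingType) (V W : lmodType K) (P : polylaw V W) :
  exists F : C1law (polylaw_base P),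
    [/\ forall (x v : V) (s t : K),
          C1map F ((x, v), (s, t)) = (polylaw_at P (s * t) (x, v), (s, t)),
        forall u : V * V, C1tangent F u = polylaw_quad P 'X^2 u,
        forall x v : V, C1differential F x v = (polylaw_at P 0 (x, v)).2
      & forall x : V, linear (fun v : V => (polylaw_at P 0 (x, v)).2)].
Proof.
pose slope x v t := (polylaw_at P t (x, v)).2.
have slopeP : difference_factorizer (polylaw_base P) slope.
  by move=> x v t; rewrite polylaw_at_target polylaw_at_source addrC addKr.
have slopeD x v v' t :
    slope x (v + v') t = slope (x + t *: v) v' t + slope x v t.
  exact: polylaw_at_add.
have slopeZ x v s t : slope x (s *: v) t = s *: slope x v (s * t).
  exact: polylaw_at_scale.
have at_slope x v r : (polylaw_base P x, slope x v r) = polylaw_at P r (x, v).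
  by rewrite -(polylaw_at_source P r x v) /slope; case: (polylaw_at _ _ _).
exists (C1Law slopeP slopeD slopeZ); split=> // [x v s t|[x v]|x a v v'].
- by rewrite /C1map /= at_slope.
- by rewrite /C1tangent /= at_slope /polylaw_at scale0r subr0.
(* At t = 0 the base point x + tv stays at x and the parameter st stays 0, so the two slope laws
   become additivity and homogeneity. *)
- by rewrite -!/(slope _ _ 0) slopeD scale0r addr0 slopeZ mulr0 addrC.
Qed.
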